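(* Assume $N:=-\lambda_1-\alpha_1\in\mathbb{Z}_{\ge0}$, $\beta<1$, $\alpha_2-\alpha_1<1$, $t_1>0$, $t_2>0$, $h_1<h_2$, $l_1<l_2$, and moreover $2N+1+h_2-l_2-\beta<0$ and $2N+l_1-l_2-\beta<0$. Let $c_{N+1}(E)$ be the polynomial in $E$ (depending on $q\in(0,1)$) defined in the context. (i) The polynomial $c_{N+1}(E)$ satisfies, as $q\to+0$, $$c_{N+1}(E)\sim (t_1t_2)^{-N-1}q^{(N/2+\lambda_1-h_1-h_2)(N+1)}\prod_{k=1}^{N+1}\left(E+q^{k-3/2+\lambda_1+l_1+\alpha_1+\alpha_2}\,t_1\right).$$ (ii) There exist solutions $E_k(q)$ $(k=1,2,\dots,N+1)$ to the equation $c_{N+1}(E)=0$ for sufficiently small $q>0$ such that $$E_k(q)\sim -q^{k-3/2+\lambda_1+l_1+\alpha_1+\alpha_2}\,t_1 .$$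
   Context: The parameters $t_1,t_2,h_1,h_2,l_1,l_2,\alpha_1,\alpha_2,\beta$ are fixed real numbers independent of $q$, and $0<q<1$ is a variable. Set $\lambda_1=(h_1+h_2-l_1-l_2-\alpha_1-\alpha_2-\beta+2)/2$. For functions of $q$: $a(q)\sim b(q)$ means $\lim_{q\to+0}a(q)/b(q)=1$. For polynomials with $q$-dependent coefficients, $\sum_{j=0}^M a_j(q)E^j\sim\sum_{j=0}^M b_j(q)E^j$ means $a_j(q)\sim b_j(q)$ for all $j=0,\dots,M$. The polynomials $c_n(E)$ are defined by $c_{-1}(E)=0$, $c_0(E)=1$ and, for $n=1,\dots,N+1$, $$c_n(E)\,t_1t_2q^{h_1+h_2}(1-q^n)(1-q^{n-\beta})=c_{n-1}(E)\Big[Eq^{n-1+\lambda_1}+q^{1/2}(q^{h_1}t_1+q^{h_2}t_2)+(q^{l_1}t_1+q^{l_2}t_2)q^{2(n-1+\lambda_1)+\alpha_1+\alpha_2-1/2}\Big]$$ $$-c_{n-2}(E)\,q\,(1-q^{n-2+\lambda_1+\alpha_1})(1-q^{n-2+\lambda_1+\alpha_2}).$$ *)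

(* Defs.v *)
From HB Require Import structures.
From mathcomp Require Import all_boot all_order all_algebra.
From mathcomp Require Import all_classical all_reals all_analysis.
Set Implicit Arguments.
Unset Strict Implicit.
Unset Printing Implicit Defensive.
Import Order.TTheory GRing.Theory Num.Theory.
Import numFieldNormedType.Exports.
Local Open Scope classical_set_scope.
Local Open Scope ring_scope.

Definition asym_equiv (R : realType) (a b : R -> R) : Prop :=
  a q / b q @[q --> 0^'+] --> (1 : R).

(* The size bounds say that, for each q in ]0, 1[, both sides can be written
   \sum_(j < M.+1) a_j(q) 'X^j. *)
Definition poly_asym_equiv (R : realType) (M : nat) (a b : R -> {poly R}) :
    Prop :=
  (forall q : R, 0 < q < 1 ->
     (size (a q) <= M.+1)%N /\ (size (b q) <= M.+1)%N) /\
  (forall j : nat, (j <= M)%N ->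
     asym_equiv (fun q => (a q)`_j) (fun q => (b q)`_j)).

Definition lambda1 (R : realType) (h1 h2 l1 l2 alpha1 alpha2 beta : R) : R :=
  (h1 + h2 - l1 - l2 - alpha1 - alpha2 - beta + 2) / 2.

Section Coefficients.
Variables (R : realType) (t1 t2 h1 h2 l1 l2 alpha1 alpha2 beta q : R).

Let lam : R := lambda1 h1 h2 l1 l2 alpha1 alpha2 beta.

(* The recurrence reads
     c_den n * c_n(E) = c_lin n * c_{n-1}(E) - c_off n * c_{n-2}(E),  n >= 1,
   with c_{-1} = 0 and c_0 = 1; c_poly solves it for c_n, see c_poly_recE. *)
Definition c_den (n : nat) : R :=
  t1 * t2 * q `^ (h1 + h2) * (1 - q ^+ n) * (1 - q `^ (n%:R - beta)).

Definition c_lin (n : nat) : {poly R} :=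
  q `^ (n%:R - 1 + lam) *: 'X
  + (q `^ (1 / 2) * (q `^ h1 * t1 + q `^ h2 * t2)
     + (q `^ l1 * t1 + q `^ l2 * t2)
       * q `^ (2 * (n%:R - 1 + lam) + alpha1 + alpha2 - 1 / 2))%:P.

Definition c_off (n : nat) : R :=
  q * (1 - q `^ (n%:R - 2 + lam + alpha1))
    * (1 - q `^ (n%:R - 2 + lam + alpha2)).

Fixpoint c_poly (n : nat) : {poly R} :=
  match n with
  | 0%N => 1
  | m.+1 =>
      (c_den m.+1)^-1 *:
        (c_poly m * c_lin m.+1
         - c_off m.+1 *: (match m with 0%N => 0 | p.+1 => c_poly p end))
  end.

Lemma c_den_neq0 (n : nat) :
  0 < q < 1 -> t1 != 0 -> t2 != 0 -> beta < 1 -> c_den n.+1 != 0.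
Proof.
move=> /andP[q0 q1] t10 t20 b1; rewrite /c_den !mulf_neq0 //.
- by rewrite gt_eqF// powR_gt0.
- by rewrite subr_eq0 eq_sym lt_eqF// exprn_ilt1// ltW.
- rewrite subr_eq0 eq_sym lt_eqF// /powR gt_eqF// -[X in _ < X]expR0 ltr_expR.
  rewrite pmulr_rlt0 ?ln_lt0 ?q0//.
  by rewrite subr_gt0 (lt_le_trans b1) ?ler1n.
Qed.

Lemma c_poly_recE (n : nat) :
  0 < q < 1 -> t1 != 0 -> t2 != 0 -> beta < 1 ->
  c_den n.+1 *: c_poly n.+1 =
    c_poly n * c_lin n.+1 - c_off n.+1 *: (if n is p.+1 then c_poly p else 0).
Proof.
by move=> q01 t10 t20 b1; rewrite /= scalerA divff ?scale1r// c_den_neq0.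
Qed.

End Coefficients.

(* Main.v *)
Require Import Defs.
From HB Require Import structures.
From mathcomp Require Import all_boot all_order all_algebra.
From mathcomp Require Import all_classical all_reals all_analysis.
From mathcomp Require Import ring lra.
Set Implicit Arguments.
Unset Strict Implicit.
Unset Printing Implicit Defensive.
Import Order.TTheory GRing.Theory Num.Theory.
Import numFieldNormedType.Exports.
Local Open Scope classical_set_scope.
Local Open Scope ring_scope.

(** As [q] tends to [0], the bracket in the recurrence is dominated by its
    terms [E q^(n-1+lam)] and [q^l1 t1 q^(2(n-1+lam)+alpha1+alpha2-1/2)]: the
    other terms carry the larger exponents coming from [h1 < h2], [l1 < l2] and
    [2N+1+h2-l2-beta < 0].  Hence, apart from the term in [c_{n-2}], each step
    multiplies [c_{n-1}] by [a_n E + b_n], up to relative errors tending to [0]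
    in both coefficients, with [a_n, b_n > 0] explicit monomials in [q].  The
    term in [c_{n-2}] is harmless because its coefficient is [o(b_n b_{n-1})]
    whereas [c_{n-1}] is at least of the size of [b_{n-1} c_{n-2}]; this is what
    [2N+l1-l2-beta < 0] says, using that [lam + alpha1 = -N] and
    [alpha2 - alpha1 < 1] make the exponents in [c_off] negative.  As all the
    coefficients of the product [P_n = (a_1 E + b_1) ... (a_n E + b_n)] are
    nonnegative, no cancellation can occur, and an induction on [n] shows that
    every coefficient of [c_n] equals that of [P_n] up to a relative error
    tending to [0]
    ([coef_close_step], [coef_asym_rec], [c_poly_coef_asym]).  Pulling out the
    [a_k] gives the first assertion.

    For the roots, a coefficientwise relative error [e] with respect to a
    polynomial [P] with nonnegative coefficients gives
    [|p(x) - P(x)| <= e P(|x|)].  The roots [- r_k] of [P] satisfy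
    [r_(k+1) / r_k = q], hence are widely separated, so that at
    [x = - r_k (1 +- d)] the ratio [P(|x|) / |P(x)|] is bounded independently
    of [q].  For small [e] the values of [p] at these two points then have the
    signs of those of [P], which are opposite, and the intermediate value
    theorem provides a root of [p] in between ([separated_root]).  The widths
    [d] obtained tend to [0], and choosing for each [q] an almost nearest root
    gives one function of [q] ([near_selection], [separated_roots_asym]). *)

(** * Coefficientwise relative closeness *)

Section CoefClose.
Variable R : realFieldType.
Implicit Types (p P : {poly R}) (e u v w a b x y : R).

(** Where a coefficient of [P] vanishes, so does that of [p]; thus the same
    estimate is meaningful for all [j], including those above the degree. *)
Definition coef_close e p P : Prop := forall j, `|p`_j - P`_j| <= e * P`_j.

Lemma coef_close_ge0 e p P : 0 < e -> coef_close e p P -> forall j, 0 <= P`_j.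
Proof.
by move=> e0 pP j; rewrite -(pmulr_rge0 _ e0); apply: le_trans (pP j).
Qed.

Lemma relerr_mul e u a x y : 0 < e <= 1 -> 0 <= a -> 0 <= y ->
  `|u - a| <= e * a -> `|x - y| <= e * y -> `|u * x - a * y| <= 3 * e * (a * y).
Proof.
move=> /andP[e0 e1] a0 y0 ua xy.
have -> : u * x - a * y = (u - a) * y + (u - a) * (x - y) + a * (x - y) by ring.
have h1 : `|(u - a) * y| <= e * (a * y).
  by rewrite normrM (ger0_norm y0) mulrA ler_wpM2r.
have h2 : `|a * (x - y)| <= e * (a * y).
  by rewrite normrM (ger0_norm a0) mulrCA ler_wpM2l.
have h3 : `|(u - a) * (x - y)| <= e * (a * y).
  rewrite normrM (le_trans (ler_pM _ _ ua xy))//.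
  have : 0 <= e * (1 - e) * (a * y) by rewrite !mulr_ge0// ?subr_ge0// ltW.
  by lra.
apply: le_trans (ler_normD _ _) _.
have := ler_normD ((u - a) * y) ((u - a) * (x - y)).
by lra.
Qed.

Lemma coef_linM u v p j :
  ((u *: 'X + v%:P) * p)`_j = u * ('X * p)`_j + v * p`_j.
Proof. by rewrite mulrDl -scalerAl mul_polyC coefD !coefZ. Qed.

(** One step of a three-term recurrence.  The last hypothesis makes the term in
    [p'] comparable with [b *: P], which is part of the product on the right;
    nonnegativity of [P] lets the three errors be added coefficientwise. *)
Lemma coef_close_step e u v w a b b' p P p' P' : 0 < e <= 1 ->
  0 <= a -> 0 <= b ->
  `|u - a| <= e * a -> `|v - b| <= e * b -> `|w| <= e * (b' * b) ->
  coef_close e p P -> coef_close e p' P' -> (forall j, b' * P'`_j <= P`_j) ->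
  coef_close (5 * e) ((u *: 'X + v%:P) * p - w *: p') ((a *: 'X + b%:P) * P).
Proof.
move=> e01 a0 b0 ua vb wb pP pP' PP' j.
have /andP[e0 e1] := e01.
have P0 := coef_close_ge0 e0 pP; have P'0 := coef_close_ge0 e0 pP'.
rewrite coefB coefZ !coef_linM.
have pPX : `|('X * p)`_j - ('X * P)`_j| <= e * ('X * P)`_j.
  by rewrite !coefXM; case: eqP => _; rewrite ?subrr ?normr0 ?mulr0.
have XP0 : 0 <= ('X * P)`_j by rewrite coefXM; case: eqP.
have h1 := relerr_mul e01 a0 XP0 ua pPX.
have h2 := relerr_mul e01 b0 (P0 j) vb (pP j).
have h3 : `|w * p'`_j| <= 2 * e * (b * P`_j).
  have p'2 : `|p'`_j| <= 2 * P'`_j.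
    have := ler_normD (p'`_j - P'`_j) P'`_j; rewrite subrK (ger0_norm (P'0 j)).
    have : e * P'`_j <= P'`_j by rewrite ler_piMl.
    by have := pP' j; lra.
  rewrite normrM (le_trans (ler_pM _ _ wb p'2))//.
  have : 0 <= e * (b * (P`_j - b' * P'`_j)).
    by rewrite !mulr_ge0// ?subr_ge0// ltW.
  by lra.
have aXP : 0 <= e * (a * ('X * P)`_j) by rewrite !mulr_ge0// ltW.
set A := u * _ in h1 *; set A' := a * _ in h1 aXP *.
set B := v * _ in h2 *; set B' := b * _ in h2 h3 *; set C := w * _ in h3 *.
have -> : A + B - C - (A' + B') = (A - A') + (B - B') - C by ring.
have := ler_normB ((A - A') + (B - B')) C.
have := ler_normD (A - A') (B - B').
by lra.
Qed.

Lemma prod_lin_coef_ge0 n (a b : nat -> R) :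
  (forall i, 0 <= a i) -> (forall i, 0 <= b i) ->
  forall j, 0 <= (\prod_(i < n) (a i *: 'X + (b i)%:P))`_j.
Proof.
move=> a0 b0; elim: n => [|n IH] j.
  by rewrite big_ord0 coef1; case: eqP.
rewrite big_ord_recr /= mulrC coef_linM coefXM.
by rewrite addr_ge0// mulr_ge0//; case: eqP.
Qed.

Lemma prod_lin_coef_gt0 n (a b : nat -> R) :
  (forall i, 0 < a i) -> (forall i, 0 < b i) ->
  forall j, (j <= n)%N -> 0 < (\prod_(i < n) (a i *: 'X + (b i)%:P))`_j.
Proof.
move=> a0 b0; elim: n => [|n IH] j.
  by rewrite leqn0 big_ord0 coef1 => /eqP ->.
have Q0 i : 0 <= (\prod_(i < n) (a i *: 'X + (b i)%:P))`_i.
  by apply: prod_lin_coef_ge0 => k; exact: ltW.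
rewrite big_ord_recr /= mulrC coef_linM coefXM; case: j => [_|j jn] /=.
  by rewrite mulr0 add0r mulr_gt0// IH.
by rewrite ltr_wpDr ?mulr_gt0 ?mulr_ge0 ?IH// ltW.
Qed.

Lemma prod_lin_coef_le n (a b : nat -> R) :
  (forall i, 0 <= a i) -> (forall i, 0 <= b i) ->
  forall j, b n * (\prod_(i < n) (a i *: 'X + (b i)%:P))`_j <=
    (\prod_(i < n.+1) (a i *: 'X + (b i)%:P))`_j.
Proof.
move=> a0 b0 j; rewrite big_ord_recr /= [_ * (_ + _)]mulrC coef_linM lerDr.
by rewrite coefXM mulr_ge0//; case: eqP => // _; apply: prod_lin_coef_ge0.
Qed.

(** Coefficientwise closeness controls values at points of any sign, at the
    price of evaluating [P] at [`|x|], where its terms do not cancel. *)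
Lemma coef_close_horner e p P x :
  coef_close e p P -> `|p.[x] - P.[x]| <= e * P.[`|x|].
Proof.
move=> pP; pose n := maxn (size p) (size P).
rewrite (horner_coef_wide x (leq_maxl (size p) (size P))) -/n.
rewrite !(horner_coef_wide _ (leq_maxr (size p) (size P))) -/n.
rewrite -sumrB mulr_sumr; apply: le_trans (ler_norm_sum _ _ _) _.
apply: ler_sum => i _; rewrite -mulrBl normrM normrX mulrA.
by rewrite ler_wpM2r// exprn_ge0.
Qed.

End CoefClose.

(** * Roots near those of a product with separated roots *)

Section Roots.
Variable R : rcfType.

Lemma poly_root_sign_change (p : {poly R}) (x y : R) : x <= y ->
  p.[x] * p.[y] < 0 -> exists2 z, x <= z <= y & p.[z] = 0.
Proof.
move=> xy; have [px|px|->] := ltgtP p.[x] 0; last by rewrite mul0r ltxx.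
  rewrite nmulr_rlt0// => py; have [|z xzy /rootP] := @Num.poly_ivt _ p _ _ xy.
    by rewrite !ltW.
  by exists z.
rewrite pmulr_rlt0// => py; have [|z xzy] := @Num.poly_ivt _ (- p) _ _ xy.
  by rewrite !hornerN oppr_le0 oppr_ge0 !ltW.
by rewrite rootN => /rootP; exists z.
Qed.

Lemma same_sign (a b : R) : `|a - b| < `|b| -> 0 < a * b.
Proof.
rewrite ltr_norml; case: (ltgtP b 0) => [b0|b0|->].
- by rewrite ltr0_norm// => /andP[]; nra.
- by rewrite gtr0_norm// => /andP[]; nra.
- by rewrite normr0; lra.
Qed.

(** At [x = - r k * (1 + s)] with [s = d] or [s = - d], each factor satisfies
    [`|x| + r i <= 3 / d * `|x + r i|]: for [i != k] because [`|x|] and [r i]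
    differ by a factor at least [2], and for [i = k] because [x] is at distance
    [d * r k] from the root.  So the error at [x] is smaller than [`|P.[x]|],
    and [p] changes sign with [P] between the two points. *)
Lemma separated_root m (C : R) (r : 'I_m -> R) (k : 'I_m) (e d : R)
    (p : {poly R}) :
  0 < C -> (forall i, 0 < r i) ->
  (forall i, i != k -> (4 * r i <= r k) || (4 * r k <= r i)) ->
  0 < d <= 1 / 2 -> e * (3 / d) ^+ m < 1 ->
  coef_close e p (C *: \prod_(i < m) ('X + (r i)%:P)) ->
  exists2 z, - r k * (1 + d) <= z <= - r k * (1 - d) & p.[z] = 0.
Proof.
move=> C0 r0 rsep /andP[d0 d2] ed pP.
set P := C *: _ in pP.
have rk := r0 k.
have PE x : P.[x] = C * \prod_(i < m) (x + r i).
  by rewrite /P hornerZ horner_prod; under eq_bigr do rewrite !hornerE.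
have close s : s = d \/ s = - d ->
    0 < p.[- r k * (1 + s)] * P.[- r k * (1 + s)].
  move=> sd; set x := - r k * (1 + s); apply: same_sign.
  have xE : `|x| = r k * (1 + s).
    by rewrite normrM normrN !gtr0_norm//; case: sd => ->; lra.
  have Pge0 : 0 < P.[`|x|].
    rewrite PE mulr_gt0// prodr_gt0// => i _.
    by rewrite (lt_le_trans (r0 i))// lerDr.
  apply: le_lt_trans (coef_close_horner x pP) _.
  have P3 : P.[`|x|] <= (3 / d) ^+ m * `|P.[x]|.
    rewrite !PE [`|C * _|]normrM (gtr0_norm C0) mulrCA ler_pM2l//.
    rewrite normr_prod -[m in _ ^+ m]card_ord -prodr_const -big_split/=.
    apply: ler_prod => i _; rewrite addr_ge0 ?(ltW (r0 i))//=.
    have d3 : 0 < 3 / d by rewrite divr_gt0.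
    have xri : d * (`|x| + r i) <= 3 * `|x + r i|.
      have ri := r0 i; rewrite xE /x.
      have [->|/rsep] := eqVneq i k.
        have -> : - r k * (1 + s) + r k = - s * r k by ring.
        rewrite normrM normrN (gtr0_norm rk).
        have -> : `|s| = d by case: sd => ->; rewrite ?normrN gtr0_norm.
        by rewrite [3 * _]mulrCA ler_pM2l//; case: sd => ->; nra.
      rewrite mulNr; set y := r k * (1 + s) in xE *.
      have y1 : r k <= 2 * y by case: sd => se; rewrite /y se; nra.
      have y2 : 2 * y <= 3 * r k by case: sd => se; rewrite /y se; nra.
      have dy : d * (y + r i) <= 1 / 2 * (y + r i) by rewrite ler_wpM2r//; lra.
      by move=> /orP[h|h]; [rewrite ler0_norm|rewrite ger0_norm]; lra.
    by rewrite mulrAC ler_pdivlMr// mulrC.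
  have Px : 0 < `|P.[x]|.
    rewrite normr_gt0; apply/eqP => Px0.
    by move: P3; rewrite Px0 normr0 mulr0 leNgt Pge0.
  case: (lerP e 0) => e0.
    by rewrite (le_lt_trans _ Px)// mulr_le0_ge0// ltW.
  apply: le_lt_trans (_ : e * ((3 / d) ^+ m * `|P.[x]|) < _).
    by rewrite ler_pM2l.
  by rewrite mulrA gtr_pMl.
apply: poly_root_sign_change; first by nra.
have PP : P.[- r k * (1 + d)] * P.[- r k * (1 - d)] < 0.
  rewrite !PE mulrACA -big_split/= pmulr_rlt0 ?mulr_gt0//.
  (* The factor [i = k] is the only one that changes sign. *)
  have dk0 : 0 < r k * d by rewrite mulr_gt0.
  have dk2 : r k * d <= r k * (1 / 2) by rewrite ler_pM2l.
  rewrite (bigD1 k)//= nmulr_rlt0.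
    rewrite prodr_gt0// => i /rsep; have ri := r0 i => /orP[h|h].
      by rewrite nmulr_rgt0; lra.
    by rewrite mulr_gt0//; lra.
  have -> : (- r k * (1 + d) + r k) * (- r k * (1 - d) + r k) =
      - (r k * d) ^+ 2 by ring.
  by rewrite oppr_lt0 exprn_gt0.
have := close d (or_introl erefl); have := close (- d) (or_intror erefl).
move: PP; move: (p.[_]) (p.[_]) (P.[_]) (P.[_]) => a b a' b'.
by move=> ab h1 h2; rewrite -(nmulr_lgt0 _ ab) mulrACA mulr_gt0.
Qed.

End Roots.

(** * Asymptotics as [q] tends to [0] from the right *)

Section Asym.
Variable R : realType.

Definition coef_asym (p P : R -> {poly R}) : Prop :=
  forall e, 0 < e -> \forall q \near 0^'+, coef_close e (p q) (P q).

Lemma cvg_div_relerr (a b : R -> R) (l : R) :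
  a q / b q @[q --> 0^'+] --> l -> (forall q, 0 < q -> 0 < b q) ->
  forall e, 0 < e -> \forall q \near 0^'+, `|a q - l * b q| <= e * b q.
Proof.
move=> /cvgrPdist_le abl b0 e e0; near=> q.
have bq : 0 < b q by apply: b0; near: q; exact: nbhs_right_gt.
have -> : a q - l * b q = (a q / b q - l) * b q by field; rewrite gt_eqF.
rewrite normrM (gtr0_norm bq) ler_pM2r// distrC.
by near: q; exact: abl.
Unshelve. all: by end_near. Qed.

Lemma asym_equiv_relerr (a b : R -> R) :
  asym_equiv a b -> (forall q, 0 < q -> 0 < b q) ->
  forall e, 0 < e -> \forall q \near 0^'+, `|a q - b q| <= e * b q.
Proof.
move=> ab b0 e e0; near=> q; rewrite -[X in _ - X]mul1r; near: q.
exact: cvg_div_relerr.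
Unshelve. all: by end_near. Qed.

(** Why the third term can be neglected: the products [P_n] satisfy
    [b n * b n.+1 * P_n <= P_(n+2)] coefficientwise, so a weight [w n.+1] that
    is [o(b n * b n.+1)] contributes a small relative error to the step from
    [n.+1] to [n.+2], and only [N] such errors accumulate. *)
Lemma coef_asym_rec N (c : nat -> R -> {poly R}) (u v w a b : nat -> R -> R) :
  (forall q, c 0 q = 1) ->
  (forall n q, c n.+1 q = (u n q *: 'X + (v n q)%:P) * c n q
                          - w n q *: (if n is m.+1 then c m q else 0)) ->
  (forall n q, 0 < q -> 0 < a n q) -> (forall n q, 0 < q -> 0 < b n q) ->
  (forall n, (n < N)%N -> asym_equiv (u n) (a n)) ->
  (forall n, (n < N)%N -> asym_equiv (v n) (b n)) ->
  (forall n, (n.+1 < N)%N ->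
     w n.+1 q / (b n q * b n.+1 q) @[q --> 0^'+] --> 0) ->
  forall n, (n <= N)%N ->
    coef_asym (c n) (fun q => \prod_(i < n) (a i q *: 'X + (b i q)%:P)).
Proof.
move=> c0 crec a0 b0 ua vb wbb.
pose asymc n :=
  coef_asym (c n) (fun q => \prod_(i < n) (a i q *: 'X + (b i q)%:P)).
suff H : forall n, ((n <= N)%N -> asymc n) /\ ((n.+1 <= N)%N -> asymc n.+1).
  by move=> n; have [] := H n.
have smallE (e : R) : 0 < e ->
    0 < Num.min 1 (e / 5) <= 1 /\ 5 * Num.min 1 (e / 5) <= e.
  move=> e0; rewrite lt_min ltr01 divr_gt0// ge_min lexx; split=> //.
  by rewrite mulrC -ler_pdivlMr// ge_min lexx orbT.
have closeW (e e' : R) p P : 0 < e -> e <= e' ->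
    coef_close e p P -> coef_close e' p P.
  move=> e0 ee' pP j; apply: le_trans (pP j) _.
  by rewrite ler_wpM2r// (coef_close_ge0 e0 pP).
have step n : (n < N)%N -> asymc n ->
    (if n is m.+1 then asymc m else True) -> asymc n.+1.
  move=> nN An Am e e0; have [] := smallE e e0.
  set f := Num.min _ _ => f01 fe; have /andP[f0 f1] := f01.
  (* For [n = 0] there is no third term, and all its data are taken to be 0. *)
  have [w' [b' [p' [P' [wE wq pP' PP']]]]] : exists w' b' p' P', [/\
      forall q, w n q *: (if n is m.+1 then c m q else 0) = w' q *: p' q,
      \forall q \near 0^'+, `|w' q| <= f * (b' q * b n q),
      \forall q \near 0^'+, coef_close f (p' q) (P' q) &
      forall q, 0 < q -> forall j,
        b' q * (P' q)`_j <= (\prod_(i < n) (a i q *: 'X + (b i q)%:P))`_j].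
    case: n => [|m] in nN An Am *.
      exists (fun=> 0), (fun=> 0), (fun=> 0), (fun=> 0); split=> [q|||q _ j].
      - by rewrite !scaler0.
      - by near=> q; rewrite normr0 mul0r mulr0.
      - by near=> q => j; rewrite coef0 subrr normr0 mulr0.
      - by rewrite mul0r big_ord0 coef1 ler0n.
    exists (w m.+1), (b m), (c m),
      (fun q => \prod_(i < m) (a i q *: 'X + (b i q)%:P)).
    split=> [//||| q q0]; last 1 first.
    - apply: (@prod_lin_coef_le _ m (a^~ q) (b^~ q)) => i.
        by rewrite ltW ?a0.
      by rewrite ltW ?b0.
    - near=> q; rewrite -[w _ _]subr0 -[X in _ - X](mul0r (b m q * b m.+1 q)).
      near: q; apply: (cvg_div_relerr (b := fun q => b m q * b m.+1 q)) => //.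
        exact: wbb.
      by move=> q q0; rewrite mulr_gt0// b0.
    - exact: Am.
  near=> q; have q0 : 0 < q by near: q; exact: nbhs_right_gt.
  apply: (@closeW (5 * f)) => //; first by rewrite mulr_gt0.
  rewrite big_ord_recr/= [X in coef_close _ _ X]mulrC crec wE.
  apply: (coef_close_step (b' := b' q) (P' := P' q)) => //.
  - by rewrite ltW ?a0.
  - by rewrite ltW ?b0.
  - by near: q; apply: asym_equiv_relerr => //; [exact: ua|exact: a0].
  - by near: q; apply: asym_equiv_relerr => //; [exact: vb|exact: b0].
  - by near: q.
  - by near: q; exact: An.
  - by near: q.
  - exact: PP'.
elim=> [|n [IH1 IH2]].
  have A0 : asymc 0%N.
    move=> e e0; near=> q => j; rewrite c0 big_ord0 subrr normr0.
    by rewrite mulr_ge0 ?coef1 ?ler0n// ltW.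
  by split => // N0; exact: step.
by split => // nN; apply: step => //; [exact/IH2/ltnW|exact/IH1/ltnW/ltnW].
Unshelve. all: by end_near. Qed.

Lemma coef_asym_equiv (p P : R -> {poly R}) j : coef_asym p P ->
  (\forall q \near 0^'+, 0 < (P q)`_j) ->
  asym_equiv (fun q => (p q)`_j) (fun q => (P q)`_j).
Proof.
move=> pP P0; apply/cvgrPdist_le => e e0; near=> q.
have Pj : 0 < (P q)`_j by near: q.
have -> : 1 - (p q)`_j / (P q)`_j = ((P q)`_j - (p q)`_j) / (P q)`_j.
  by field; rewrite gt_eqF.
rewrite normrM normfV (gtr0_norm Pj) ler_pdivrMr// distrC.
by near: q; have := pP e e0; apply: filterS => q; exact.
Unshelve. all: by end_near. Qed.

(** Replaces points that depend on the tolerance [e] by one function of [q]: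
    choose for each [q] a point of [A q] where [`|f q x|] exceeds its infimum by
    less than [q], which is as good as any other choice in the limit. *)
Lemma near_selection (A : R -> set R) (f : R -> R -> R) :
  (forall e, 0 < e ->
     \forall q \near 0^'+, exists2 x, A q x & `|f q x| <= e) ->
  exists E : R -> R, (\forall q \near 0^'+, A q (E q)) /\
    f q (E q) @[q --> 0^'+] --> 0.
Proof.
move=> Af.
have best q : exists x, 0 < q ->
    forall y, A q y -> A q x /\ `|f q x| < `|f q y| + q.
  have [[q0 [y Ay]]|noy] := pselect (0 < q /\ exists y, A q y); last first.
    by exists 0 => q0 y Ay; case: noy; split => //; exists y.
  pose S := [set `|f q x| | x in A q].
  have lbS : has_lbound S by exists 0 => _ [x _ <-].
  have [|_ [x Ax <-] xS] := @inf_adherent _ S q q0.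
    by split => //; exists `|f q y|, y.
  exists x => _ z Az; split=> //; apply: lt_le_trans xS _.
  by rewrite lerD2r; apply: ge_inf => //; exists z.
have [E EP] := boolp.choice best.
exists E; split.
  near=> q; have q0 : 0 < q by near: q; exact: nbhs_right_gt.
  have [y Ay _] : exists2 x, A q x & `|f q x| <= 1 by near: q; exact: Af.
  by have [] := EP q q0 y Ay.
apply/cvgrPdist_le => e e0; near=> q; rewrite sub0r normrN.
have q0 : 0 < q by near: q; exact: nbhs_right_gt.
have [y Ay fy] : exists2 x, A q x & `|f q x| <= e / 2.
  by near: q; apply: Af; rewrite divr_gt0.
have [_ /ltW/le_trans->//] := EP q q0 y Ay.
have : q < e / 2 by near: q; apply: nbhs_right_lt; rewrite divr_gt0.
by lra.
Unshelve. all: by end_near. Qed.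

(** For each [d], the [k]-th root lies within relative distance [d] of [- r k]
    as soon as [q] is small, the tolerance [f] on the coefficients being chosen
    with [f * (3 / d) ^+ m = 1 / 2]. *)
Lemma separated_roots_asym m (p : R -> {poly R}) (C : R -> R)
    (r : nat -> R -> R) :
  (forall q, 0 < q -> 0 < C q) -> (forall i q, 0 < q -> 0 < r i q) ->
  (forall i j, (i < j)%N -> \forall q \near 0^'+, 4 * r j q <= r i q) ->
  coef_asym p (fun q => C q *: \prod_(i < m) ('X + (r i q)%:P)) ->
  forall k, (k < m)%N -> exists E : R -> R,
    (\forall q \near 0^'+, (p q).[E q] = 0) /\
    asym_equiv E (fun q => - r k q).
Proof.
move=> C0 r0 rsep pP k km.
have [e e0|E [Eroot Elim]] := @near_selection
    (fun q => [set x | (p q).[x] = 0]) (fun q x => x / (- r k q) - 1).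
  pose d := Num.min e (1 / 2); pose f := (d / 3) ^+ m / 2.
  have d0 : 0 < d by rewrite lt_min e0/= divr_gt0.
  have f0 : 0 < f by rewrite !(divr_gt0, exprn_gt0).
  have fd : f * (3 / d) ^+ m < 1.
    rewrite mulrAC -exprMn.
    have -> : d / 3 * (3 / d) = 1 by field; rewrite gt_eqF.
    by rewrite expr1n; lra.
  have sep : \forall q \near 0^'+, forall i : 'I_m, i != Ordinal km ->
      (4 * r i q <= r k q) || (4 * r k q <= r i q).
    apply: filter_forall => i; have [ik|ki|/= ik] := ltngtP i k.
    - by have := rsep i k ik; apply: filterS => q -> _; rewrite orbT.
    - by have := rsep k i ki; apply: filterS => q -> _.
    - by near=> q; rewrite -val_eqE/= ik eqxx.
  near=> q; have q0 : 0 < q by near: q; exact: nbhs_right_gt.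
  have rk := r0 k q q0.
  have [||||||x /andP[x1 x2] px] := @separated_root R m (C q)
      (fun i => r i q) (Ordinal km) f d (p q) => //.
  - exact: C0.
  - by move=> i; exact: r0.
  - by near: q.
  - by rewrite d0 ge_min lexx orbT.
  - by near: q; exact: pP.
  exists x => //.
  have -> : x / (- r k q) - 1 = - (x + r k q) / r k q.
    by field; rewrite gt_eqF.
  rewrite normrM normrN normfV (gtr0_norm rk) ler_pdivrMr// ler_norml.
  have de : r k q * d <= e * r k q.
    by rewrite [e * _]mulrC ler_pM2l// ge_min lexx.
  by rewrite /= in x1 x2; apply/andP; split; lra.
exists E; split=> //; rewrite /asym_equiv -[X in _ --> X]add0r.
rewrite (_ : (fun q => _) = (fun q => (E q / (- r k q) - 1) + 1)); last first.
  by apply/funext => q; rewrite subrK.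
by apply: cvgD; [exact: Elim|exact: cvg_cst].
Unshelve. all: by end_near. Qed.

End Asym.

(** * The recurrence for [c_poly] *)

Section Limits.
Variable R : realType.

Lemma cvg_right0_eq (f g : R -> R) (l : R) :
  (forall q, 0 < q < 1 -> f q = g q) ->
  g q @[q --> 0^'+] --> l -> f q @[q --> 0^'+] --> l.
Proof.
move=> fg; apply: cvg_trans; apply: near_eq_cvg; near=> q; apply/esym/fg.
by apply/andP; split; near: q; [exact: nbhs_right_gt|exact: nbhs_right_lt].
Unshelve. all: by end_near. Qed.

Lemma powR_gt0D (q x y : R) : 0 < q -> q `^ (x + y) = q `^ x * q `^ y.
Proof. by move=> q0; rewrite powRD// (gt_eqF q0) implybT. Qed.

Lemma cvg_one_sub_powR (x : R) : 0 < x -> 1 - q `^ x @[q --> 0^'+] --> (1 : R).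
Proof.
move=> x0; rewrite -[X in _ --> X]subr0.
by apply: cvgB; [exact: cvg_cst|exact: powR_cvg0].
Qed.

End Limits.

Section Recurrence.
Variables (R : realType) (t1 t2 h1 h2 l1 l2 alpha1 alpha2 beta : R) (N : nat).
Let lam : R := lambda1 h1 h2 l1 l2 alpha1 alpha2 beta.
Hypotheses (hN : - lam - alpha1 = N%:R) (hbeta : beta < 1)
  (halpha : alpha2 - alpha1 < 1) (ht1 : 0 < t1) (ht2 : 0 < t2)
  (hh : h1 < h2) (hl : l1 < l2)
  (hA : 2 * N%:R + 1 + h2 - l2 - beta < 0)
  (hB : 2 * N%:R + l1 - l2 - beta < 0).

Let lamE : 2 * lam = h1 + h2 - l1 - l2 - alpha1 - alpha2 - beta + 2.
Proof. by rewrite /lam /lambda1; field. Qed.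

Ltac lra_params :=
  move: (hA) (hB) (hh) (hl) (halpha) (hN) (lamE); lra.

(** Opposite of the leading term of the [k]-th root. *)
Definition main_root (k : nat) (q : R) : R :=
  q `^ (k%:R - 3 / 2 + lam + l1 + alpha1 + alpha2) * t1.

(** Leading term of the coefficient of ['X] when the recurrence is solved for
    [c_poly n.+1], that is of [q `^ (n + lam) / c_den n.+1]. *)
Definition main_lin (n : nat) (q : R) : R :=
  (t1 * t2 * q `^ (h1 + h2))^-1 * q `^ (n%:R + lam).

Let den n q := c_den t1 t2 h1 h2 beta q n.
Let off n q := c_off h1 h2 l1 l2 alpha1 alpha2 beta q n.
Let c n q := c_poly t1 t2 h1 h2 l1 l2 alpha1 alpha2 beta q n.

Let unit_den n q := (1 - q ^+ n) * (1 - q `^ (n%:R - beta)).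

Let denE n q : den n q = t1 * t2 * q `^ (h1 + h2) * unit_den n q.
Proof. by rewrite /den /c_den /unit_den -!mulrA. Qed.

Let unit_den_neq0 n q : 0 < q < 1 -> unit_den n.+1 q != 0.
Proof.
move=> q01; have := @c_den_neq0 R t1 t2 h1 h2 beta q n q01 _ _ hbeta.
rewrite (gt_eqF ht1) (gt_eqF ht2) => /(_ isT isT); rewrite -/(den _ _) denE.
by rewrite mulf_eq0 => /norP[].
Qed.

Let cvg_unit_den n : (unit_den n.+1 q)^-1 @[q --> 0^'+] --> (1 : R).
Proof.
rewrite -[X in _ --> X]invr1; apply: cvgV; first exact: oner_neq0.
rewrite -[X in _ --> X]mulr1; apply: cvgM.
  apply: cvg_right0_eq (cvg_one_sub_powR (ltr0Sn R n)) => q /andP[q0 _].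
  by rewrite powR_mulrn// ltW.
apply: cvg_one_sub_powR; rewrite subr_gt0 (lt_le_trans hbeta)//.
by rewrite ler1n.
Qed.

Let coef_u n q := (den n.+1 q)^-1 * q `^ (n.+1%:R - 1 + lam).
Let coef_v n q := (den n.+1 q)^-1 *
  (q `^ (1 / 2) * (q `^ h1 * t1 + q `^ h2 * t2)
     + (q `^ l1 * t1 + q `^ l2 * t2)
       * q `^ (2 * (n.+1%:R - 1 + lam) + alpha1 + alpha2 - 1 / 2)).
Let coef_w n q := (den n.+1 q)^-1 * off n.+1 q.

Let c_rec n q : c n.+1 q = (coef_u n q *: 'X + (coef_v n q)%:P) * c n q
  - coef_w n q *: (if n is m.+1 then c m q else 0).
Proof.
rewrite {1}/c /= scalerBr scalerA -/(c n q) -/(den n.+1 q) -/(off n.+1 q).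
rewrite -/(coef_w n q); congr (_ - _).
rewrite /c_lin scalerAr scalerDr scalerA -mul_polyC -[_ *: _%:P]mul_polyC.
by rewrite -polyCM mul_polyC mulrC.
Qed.

Let main_lin_gt0 n q : 0 < q -> 0 < main_lin n q.
Proof.
by move=> q0; rewrite mulr_gt0 ?invr_gt0 ?mulr_gt0 ?powR_gt0.
Qed.

Let main_root_gt0 k q : 0 < q -> 0 < main_root k q.
Proof. by move=> q0; rewrite mulr_gt0 ?powR_gt0. Qed.

Let asym_u n : asym_equiv (coef_u n) (main_lin n).
Proof.
apply: cvg_right0_eq (cvg_unit_den n) => q q01; have /andP[q0 _] := q01.
have d0 := unit_den_neq0 n q01.
rewrite /coef_u /main_lin denE -[n.+1%:R]natr1 addrK.
by field; rewrite d0 !gt_eqF ?powR_gt0.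
Qed.

(** The exponent [x] is that of the term in [h1] relative to the dominant term,
    the one in [l1]. *)
Let asym_v n : (n <= N)%N ->
  asym_equiv (coef_v n) (fun q => main_lin n q * main_root n.+1 q).
Proof.
move=> nN'; have nN : (n%:R : R) <= N%:R by rewrite ler_nat.
pose x := - (2 * n%:R + 1 + h2 - l2 - beta).
have x0 : 0 < x by rewrite oppr_gt0; lra_params.
apply: (@cvg_right0_eq _ _ (fun q => (unit_den n.+1 q)^-1 *
   (q `^ x + q `^ (x + (h2 - h1)) * (t2 / t1)
     + (1 + q `^ (l2 - l1) * (t2 / t1))))).
  move=> q q01; have /andP[q0 _] := q01; have d0 := unit_den_neq0 n q01.
  rewrite /coef_v /main_lin /main_root denE.
  pose s := n.+1%:R - 3 / 2 + lam + l1 + alpha1 + alpha2; rewrite -/s.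
  have -> : q `^ (2 * (n.+1%:R - 1 + lam) + alpha1 + alpha2 - 1 / 2) =
      q `^ (n%:R + lam) * q `^ s * q `^ (- l1).
    rewrite -!powR_gt0D//; congr (_ `^ _).
    by rewrite /s -[n.+1%:R]natr1; lra_params.
  have e1 : q `^ (1 / 2) * q `^ h1 = q `^ x * (q `^ (n%:R + lam) * q `^ s).
    rewrite -!powR_gt0D//; congr (_ `^ _).
    by rewrite /s /x -[n.+1%:R]natr1; lra_params.
  have -> : q `^ h2 = q `^ h1 * q `^ (h2 - h1).
    by rewrite -!powR_gt0D//; congr (_ `^ _); lra_params.
  rewrite [q `^ (x + _)]powR_gt0D// [q `^ (l2 - l1)]powR_gt0D// powRN.
  have -> : q `^ (1 / 2) * (q `^ h1 * t1 + q `^ h1 * q `^ (h2 - h1) * t2) =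
      (q `^ (1 / 2) * q `^ h1) * (t1 + q `^ (h2 - h1) * t2) by ring.
  rewrite e1.
  by field; rewrite d0 !gt_eqF ?powR_gt0.
rewrite -[X in _ --> X]mulr1; apply: cvgM; first exact: cvg_unit_den.
rewrite -[X in _ --> X]add0r; apply: cvgD.
  rewrite -[X in _ --> X]addr0; apply: cvgD; first exact: powR_cvg0.
  rewrite -[X in _ --> X](mul0r (t2 / t1)); apply: cvgM; last exact: cvg_cst.
  by apply: powR_cvg0; lra_params.
rewrite -[X in _ --> X]addr0; apply: cvgD; first exact: cvg_cst.
rewrite -[X in _ --> X](mul0r (t2 / t1)); apply: cvgM; last exact: cvg_cst.
by apply: powR_cvg0; lra_params.
Qed.

(** In [c_off n.+2] both exponents are negative, namely [- y1] and [- y2], and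
    [1 - q `^ (- y)] is asymptotic to [- q `^ (- y)]; [x] is the exponent of [q]
    left in the quotient. *)
Let cvg_w n : (n.+1 <= N)%N ->
  coef_w n.+1 q / (main_lin n q * main_root n.+1 q
                   * (main_lin n.+1 q * main_root n.+2 q))
    @[q --> 0^'+] --> 0.
Proof.
move=> nN'; have nN : (n%:R : R) + 1 <= N%:R by rewrite natr1 ler_nat.
pose x := - (2 * (n%:R + 1) + l1 - l2 - beta).
pose y1 := - (n%:R + lam + alpha1); pose y2 := - (n%:R + lam + alpha2).
have x0 : 0 < x by rewrite oppr_gt0; lra_params.
apply: (@cvg_right0_eq _ _ (fun q => (unit_den n.+2 q)^-1 * (t2 / t1) * q `^ x
    * (1 - q `^ y1) * (1 - q `^ y2))).
  move=> q q01; have /andP[q0 _] := q01; have d0 := unit_den_neq0 n.+1 q01.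
  rewrite /coef_w /main_lin /main_root denE /off /c_off -/lam.
  pose s := n.+1%:R - 3 / 2 + lam + l1 + alpha1 + alpha2; rewrite -/s.
  pose s' := n.+2%:R - 3 / 2 + lam + l1 + alpha1 + alpha2; rewrite -/s'.
  have -> : n.+2%:R - 2 + lam + alpha1 = - y1.
    by rewrite /y1 -[n.+2%:R]natr1 -[n.+1%:R]natr1; lra_params.
  have -> : n.+2%:R - 2 + lam + alpha2 = - y2.
    by rewrite /y2 -[n.+2%:R]natr1 -[n.+1%:R]natr1; lra_params.
  have e1 : q * q `^ (h1 + h2) =
      q `^ x * q `^ y1 * q `^ y2 *
      (q `^ (n%:R + lam) * q `^ (n.+1%:R + lam) * q `^ s * q `^ s').
    rewrite -{1}[q]powRr1 ?ltW// -!powR_gt0D//; congr (_ `^ _).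
    by rewrite /s /s' /x /y1 /y2 -[n.+2%:R]natr1 -[n.+1%:R]natr1; lra_params.
  rewrite [q `^ (- y1)]powRN [q `^ (- y2)]powRN.
  rewrite [LHS](_ : _ =
    (unit_den n.+2 q)^-1 * (t2 / t1) * (q * q `^ (h1 + h2)) /
    (q `^ (n%:R + lam) * q `^ (n.+1%:R + lam) * q `^ s * q `^ s') *
    (1 - (q `^ y1)^-1) * (1 - (q `^ y2)^-1)).
    by rewrite e1; field; rewrite d0 !gt_eqF ?powR_gt0.
  by field; rewrite d0 !gt_eqF ?powR_gt0.
have e0 : 1 * (t2 / t1) * 0 * 1 * 1 = 0 :> R by rewrite mulr0 !mul0r.
rewrite -[X in _ --> X]e0.
apply: cvgM; last by apply: cvg_one_sub_powR; rewrite /y2; lra_params.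
apply: cvgM; last by apply: cvg_one_sub_powR; rewrite /y1; lra_params.
apply: cvgM; last exact: powR_cvg0.
by apply: cvgM; [exact: cvg_unit_den|exact: cvg_cst].
Qed.

Lemma c_poly_coef_asym : coef_asym (c N.+1)
  (fun q => \prod_(i < N.+1)
    (main_lin i q *: 'X + (main_lin i q * main_root i.+1 q)%:P)).
Proof.
apply: (@coef_asym_rec _ N.+1 c coef_u coef_v coef_w main_lin
  (fun n q => main_lin n q * main_root n.+1 q)) => //.
- by move=> n q q0; rewrite mulr_gt0 ?main_lin_gt0 ?main_root_gt0.
Qed.

End Recurrence.

(** * The leading polynomial and its roots *)

Section Params.
Variables (R : realType) (t1 t2 h1 h2 l1 l2 alpha1 alpha2 beta : R).
Let lam : R := lambda1 h1 h2 l1 l2 alpha1 alpha2 beta.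

Lemma size_c_poly q n :
  (size (c_poly t1 t2 h1 h2 l1 l2 alpha1 alpha2 beta q n) <= n.+1)%N.
Proof.
pose c := c_poly t1 t2 h1 h2 l1 l2 alpha1 alpha2 beta q.
suff H : (size (c n) <= n.+1)%N /\ (size (c n.+1) <= n.+2)%N by have [] := H.
have step m (p : {poly R}) : (size (c m) <= m.+1)%N -> (size p <= m.+2)%N ->
    (size ((c_den t1 t2 h1 h2 beta q m.+1)^-1 *:
     (c m * c_lin t1 t2 h1 h2 l1 l2 alpha1 alpha2 beta q m.+1 -
       c_off h1 h2 l1 l2 alpha1 alpha2 beta q m.+1 *: p))
       <= m.+2)%N.
  move=> cm pm; apply: leq_trans (size_scale_leq _ _) _.
  apply: leq_trans (size_polyD _ _) _; rewrite geq_max size_polyN.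
  apply/andP; split.
    apply: leq_trans (size_polyMleq _ _) _.
    have lin2 :
        (size (c_lin t1 t2 h1 h2 l1 l2 alpha1 alpha2 beta q m.+1) <= 2)%N.
      apply: leq_trans (size_polyD _ _) _; rewrite geq_max.
      rewrite (leq_trans (size_scale_leq _ _)) ?size_polyX//.
      by rewrite (leq_trans (size_polyC_leq1 _)).
    by rewrite -subn1 leq_subLR add1n -addn2 leq_add.
  exact: leq_trans (size_scale_leq _ _) _.
elim: n => [|n [IH1 IH2]].
  split; first by rewrite size_poly1.
  by apply: step; rewrite ?size_poly1 ?size_poly0.
split=> //; apply: (step n.+1 (c n)) => //.
by apply: leq_trans IH1 _; rewrite ltnW.
Qed.

(** The exponent of [q] collects [- n * (h1 + h2)] and the sum of [i + lam] over
    [i < n], which is [n * ((n - 1) / 2 + lam)]. *)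
Lemma prod_main_lin n q : 0 < q ->
  \prod_(i < n) main_lin t1 t2 h1 h2 l1 l2 alpha1 alpha2 beta i q =
    (t1 * t2) ^- n * q `^ (((n%:R - 1) / 2 + lam - h1 - h2) * n%:R).
Proof.
move=> q0; elim: n => [|n IH].
  by rewrite big_ord0 expr0 invr1 mulr0 powRr0 mulr1.
have -> : ((n.+1%:R - 1) / 2 + lam - h1 - h2) * n.+1%:R =
    ((n%:R - 1) / 2 + lam - h1 - h2) * n%:R - (h1 + h2) + (n%:R + lam).
  by rewrite -[n.+1%:R]natr1; field.
rewrite big_ord_recr/= IH /main_lin -/lam !powR_gt0D// [q `^ - _]powRN exprS.
by rewrite !powR_gt0D// !invfM; ring.
Qed.

(** Consecutive values of [main_root] have ratio [q], at most [1 / 4] near [0]. *)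
Lemma main_root_sep i j : 0 < t1 -> (i < j)%N -> \forall q \near 0^'+,
  4 * main_root t1 h1 h2 l1 l2 alpha1 alpha2 beta j q <=
      main_root t1 h1 h2 l1 l2 alpha1 alpha2 beta i q.
Proof.
move=> t10 ij; near=> q; have q0 : 0 < q by near: q; exact: nbhs_right_gt.
have q4 : q <= 1 / 4 by near: q; apply: nbhs_right_ltW; rewrite divr_gt0.
rewrite /main_root mulrA; set e := lambda1 _ _ _ _ _ _ _.
have ijR : (i.+1%:R : R) <= j%:R by rewrite ler_nat.
apply: ler_wpM2r; first exact: ltW.
apply: (@le_trans _ _
  (4 * (q `^ 1 * q `^ (i%:R - 3 / 2 + e + l1 + alpha1 + alpha2)))).
  rewrite ler_pM2l// -powR_gt0D//; apply: ger_powR; first by rewrite q0; lra.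
  by move: ijR; rewrite -[i.+1%:R]natr1; lra.
by rewrite (powRr1 (ltW q0)) mulrA ler_piMl ?powR_ge0//; lra.
Unshelve. all: by end_near. Qed.

End Params.

Theorem theorem4p5 (R : realType)
    (t1 t2 h1 h2 l1 l2 alpha1 alpha2 beta lam : R) (N : nat)
    (hlam : lam = lambda1 h1 h2 l1 l2 alpha1 alpha2 beta)
    (hN : - lam - alpha1 = N%:R)
    (hbeta : beta < 1)
    (halpha : alpha2 - alpha1 < 1)
    (ht1 : 0 < t1) (ht2 : 0 < t2)
    (hh : h1 < h2) (hl : l1 < l2)
    (hA : 2 * N%:R + 1 + h2 - l2 - beta < 0)
    (hB : 2 * N%:R + l1 - l2 - beta < 0) :
  poly_asym_equiv N.+1
    (fun q => c_poly t1 t2 h1 h2 l1 l2 alpha1 alpha2 beta q N.+1)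
    (fun q => ((t1 * t2) ^- N.+1
                 * q `^ ((N%:R / 2 + lam - h1 - h2) * (N%:R + 1))) *:
       \prod_(1 <= k < N.+2)
         ('X + (q `^ (k%:R - 3 / 2 + lam + l1 + alpha1 + alpha2) * t1)%:P))
  /\
  exists E : nat -> R -> R,
    (\forall q \near 0^'+, forall k : nat, (1 <= k <= N.+1)%N ->
       (c_poly t1 t2 h1 h2 l1 l2 alpha1 alpha2 beta q N.+1).[E k q] = 0) /\
    (forall k : nat, (1 <= k <= N.+1)%N ->
       asym_equiv (E k)
         (fun q => - (q `^ (k%:R - 3 / 2 + lam + l1 + alpha1 + alpha2) * t1))).
Proof.
subst lam.
pose a := main_lin t1 t2 h1 h2 l1 l2 alpha1 alpha2 beta.
pose r := main_root t1 h1 h2 l1 l2 alpha1 alpha2 beta.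
pose c q := c_poly t1 t2 h1 h2 l1 l2 alpha1 alpha2 beta q N.+1.
pose C q := (t1 * t2) ^- N.+1 * q `^ ((N%:R / 2 +
  lambda1 h1 h2 l1 l2 alpha1 alpha2 beta - h1 - h2) * (N%:R + 1)).
pose P q := C q *: \prod_(i < N.+1) ('X + (r i.+1 q)%:P).
have r0 k q : 0 < q -> 0 < r k q by move=> q0; rewrite mulr_gt0 ?powR_gt0.
have a0 k q : 0 < q -> 0 < a k q.
  by move=> q0; rewrite mulr_gt0 ?invr_gt0 ?mulr_gt0 ?powR_gt0.
have C0 q : 0 < q -> 0 < C q.
  by move=> q0; rewrite mulr_gt0 ?invr_gt0 ?exprn_gt0 ?mulr_gt0 ?powR_gt0.
have PE q : 0 < q ->
    \prod_(i < N.+1) (a i q *: 'X + (a i q * r i.+1 q)%:P) = P q.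
  move=> q0; rewrite /P /C.
  have -> : N%:R / 2 + lambda1 h1 h2 l1 l2 alpha1 alpha2 beta - h1 - h2 =
      (N.+1%:R - 1) / 2 + lambda1 h1 h2 l1 l2 alpha1 alpha2 beta - h1 - h2.
    by rewrite -[N.+1%:R]natr1 addrK.
  rewrite natr1 -prod_main_lin// -scaler_prod; apply: eq_bigr => i _.
  by rewrite scalerDr polyCM mul_polyC.
have cP : coef_asym c P.
  move=> e e0; near=> q; rewrite -PE; last by near: q; exact: nbhs_right_gt.
  by near: q; exact: c_poly_coef_asym.
split; last first.
  have roots k : exists E : R -> R, (1 <= k <= N.+1)%N ->
      (\forall q \near 0^'+, (c q).[E q] = 0) /\
      asym_equiv E (fun q => - r k q).
    case: k => [|k]; first by exists (fun=> 0).
    have [Nk|] := ltnP N k.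
      by exists (fun=> 0); rewrite /= ltnS leqNgt Nk.
    rewrite -ltnS => kN.
    have [||E EP] := @separated_roots_asym R N.+1 c C (fun i => r i.+1)
      C0 _ _ cP k kN.
    - by move=> i q; exact: r0.
    - by move=> i j ij; exact: main_root_sep.
    by exists E.
  have [E EP] := boolp.choice roots.
  exists E; split=> [|k kN]; last by have [] := EP k kN.
  have : \forall q \near 0^'+, forall i : 'I_N.+1, (c q).[E i.+1 q] = 0.
    by apply: filter_forall => i; have [] := EP i.+1 (ltn_ord i).
  apply: filterS => q cE [|k]// kN; exact: (cE (Ordinal kN)).
rewrite [X in poly_asym_equiv _ _ X](_ : _ = P); last first.
  by apply/funext => q; rewrite /P /C big_add1/= big_mkord.
split=> [q /andP[q0 q1]|j jN].
  split; first exact: size_c_poly.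
  apply: leq_trans (size_scale_leq _ _) _.
  have := @size_prod_XsubC R _ (index_enum 'I_N.+1) (fun i => - r i.+1 q).
  rewrite /index_enum -enumT size_enum_ord => <-.
  by under [in X in (_ <= X)%N]eq_bigr do rewrite polyCN opprK.
apply: coef_asym_equiv => //; near=> q.
have q0 : 0 < q by near: q; exact: nbhs_right_gt.
rewrite -PE//; apply: (@prod_lin_coef_gt0 _ _ (a^~ q)
  (fun i => a i q * r i.+1 q)) => // i.
  exact: a0.
by rewrite mulr_gt0 ?a0 ?r0.
Unshelve. all: by end_near. Qed.
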